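(* Let $\boldsymbol{\Psi}_{p,\ell}=\mathbf{D}\,\mathrm{diag}(\mathbf{z}_{p,\ell})\boldsymbol{\Phi}$ and $\boldsymbol{\Psi}_{u,m}=\mathbf{D}\,\mathrm{diag}(\mathbf{z}_{u,m})\boldsymbol{\Phi}$ for $\ell,m\in\{0,\ldots,L-1\}$, where $\mathbf{D}\in\mathbb{C}^{N\times N}$ satisfies $\mathbf{D}^H\mathbf{D}=\mathbf{I}$, $\boldsymbol{\Phi}\in\mathbb{C}^{N\times Q}$ is the BEM basis matrix, and $\mathbf{z}_{p,\ell},\mathbf{z}_{u,m}\in\mathbb{C}^N$ are the shifted pilot and payload vectors. If $$\mathbf{z}_{p,\ell}^{*}\odot\mathbf{z}_{u,m}=\mathbf{0}\quad\text{for all }\ell,m\in\{0,1,\ldots,L-1\},$$ then $\boldsymbol{\Psi}_{p,\ell}^{H}\boldsymbol{\Psi}_{u,m}=\mathbf{0}$ for all $\ell,m\in\{0,1,\ldots,L-1\}$.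
   Context: $N,L,Q$ are positive integers. $\odot$ denotes the entrywise (Hadamard) product, $(\cdot)^*$ entrywise complex conjugation, $(\cdot)^H$ conjugate transpose. The transmitted block is $\mathbf{x}=\mathbf{x}_p+\mathbf{x}_u\in\mathbb{C}^N$ with $\mathbf{x}_p$ the pilot part and $\mathbf{x}_u$ the payload part. The shifted vectors are $\mathbf{z}_{p,\ell}=\mathbf{S}_\ell\mathbf{x}_p$ and $\mathbf{z}_{u,m}=\mathbf{S}_m\mathbf{x}_u$, where the $\mathbf{S}_\ell\in\mathbb{C}^{N\times N}$, $\ell=0,\ldots,L-1$, are the delay-shift operators determined by the guard mode (indices in $\{0,\ldots,N-1\}$): cyclic prefix, $\mathbf{S}_\ell=\boldsymbol{\Pi}^\ell$ with $\boldsymbol{\Pi}$ the cyclic permutation matrix $(\boldsymbol{\Pi}\mathbf{x})[n]=\mathbf{x}[(n-1)\bmod N]$; zero padding, $[\mathbf{S}_\ell]_{n,k}=1$ if $n=k+\ell$ and $0$ otherwise; or chirp periodic prefix, $\mathbf{S}_\ell=\boldsymbol{\Omega}_\ell\boldsymbol{\Pi}^\ell$ with $\boldsymbol{\Omega}_\ell=\mathrm{diag}(\omega_\ell[k])_{k=0}^{N-1}$, $\omega_\ell[k]=e^{j2\pi c_1(\ell^2-2\ell k)/N}$ for $k<\ell$ and $1$ otherwise ($c_1$ a real parameter). The matrices $\boldsymbol{\Psi}_{p,\ell}$ and $\boldsymbol{\Psi}_{u,m}$ are the $\ell$-th and $m$-th block columns of the pilot and payload sensing matrices. *)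

(* Defs.v *)
From mathcomp Require Import all_boot all_order all_algebra.
From mathcomp Require Import sesquilinear spectral complex.
From mathcomp Require Import reals trigo.

Set Implicit Arguments.
Unset Strict Implicit.
Unset Printing Implicit Defensive.

Import Order.TTheory GRing.Theory Num.Theory.
Local Open Scope ring_scope.

(* The conjugate transpose is the [M ^t*] of spectral.v. *)

Definition conj_mx (R : realType) (m n : nat) (A : 'M[R[i]]_(m, n)) :
  'M[R[i]]_(m, n) := map_mx Num.conj A.

Definition hadamard (R : realType) (m n : nat) (A B : 'M[R[i]]_(m, n)) :
  'M[R[i]]_(m, n) := map2_mx *%R A B.

Definition cexpi (R : realType) (t : R) : R[i] := Complex (cos t) (sin t).

(* [ord_pred n] is (n - 1) mod N, so that (Pi x)[n] = x[(n - 1) mod N]. *)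
Definition cyclic_perm_mx (R : realType) (N : nat) : 'M[R[i]]_N :=
  \matrix_(n < N, k < N) (k == ord_pred n)%:R.

Inductive guard_mode (R : Type) : Type :=
| CyclicPrefix
| ZeroPadding
| ChirpPeriodicPrefix (c1 : R).

(* The exponent is computed in R: l ^ 2 - 2 l k is negative when k > l / 2. *)
Definition chirp_phase (R : realType) (c1 : R) (N l k : nat) : R[i] :=
  if (k < l)%N then
    cexpi (2 * pi * c1 * (l%:R ^+ 2 - 2 * l%:R * k%:R) / N%:R)
  else 1.

Definition chirp_mx (R : realType) (c1 : R) (N l : nat) : 'M[R[i]]_N :=
  diag_mx (\row_(k < N) chirp_phase c1 N l k).

Definition shift_mx (R : realType) (N : nat) (g : guard_mode R) (l : nat) :
  'M[R[i]]_N :=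
  match g with
  | CyclicPrefix => cyclic_perm_mx R N ^+ l
  | ZeroPadding => \matrix_(n < N, k < N) (n == k + l :> nat)%N%:R
  | ChirpPeriodicPrefix c1 => chirp_mx c1 N l *m cyclic_perm_mx R N ^+ l
  end.

Definition shifted_vec (R : realType) (N : nat) (g : guard_mode R) (l : nat)
  (x : 'cV[R[i]]_N) : 'cV[R[i]]_N := shift_mx N g l *m x.

Definition sensing_block (R : realType) (N Q : nat) (D : 'M[R[i]]_N)
  (Phi : 'M[R[i]]_(N, Q)) (z : 'cV[R[i]]_N) : 'M[R[i]]_(N, Q) :=
  D *m diag_mx z^T *m Phi.

(* Main.v *)
Require Import Defs.
From mathcomp Require Import all_boot all_order all_algebra.
From mathcomp Require Import sesquilinear spectral complex reals.
Import GRing.Theory.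
Local Open Scope ring_scope.
Local Open Scope sesquilinear_scope.

(** Since [D] has orthonormal columns, it preserves inner products and cancels from the product of
    two blocks, leaving [Phi ^t*], a product of two diagonal matrices, and [Phi]
    ([sensing_block_adjM]). That middle factor is diagonal and carries the Hadamard product of the
    conjugated pilot and the payload, so it vanishes ([mul_diag_adj_eq0]). *)

Lemma mul_diag_adj_eq0 (R : realType) (N : nat) (u v : 'cV[R[i]]_N) :
  hadamard (conj_mx u) v = 0 -> (diag_mx u^T) ^t* *m diag_mx v^T = 0.
Proof.
move=> /matrixP uv0; rewrite tr_diag_mx map_diag_mx mulmx_diag.
apply/matrixP => i j; rewrite !mxE.
(* Entry [(i, j)] is the [i]-th Hadamard entry [*+ (i == j)], so diagonal and off-diagonal cases are
   settled together. *)
by have := uv0 i 0; rewrite !mxE => ->; rewrite mul0rn.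
Qed.

Lemma sensing_block_adjM (R : realType) (N Q : nat) (D : 'M[R[i]]_N)
  (Phi : 'M[R[i]]_(N, Q)) (u v : 'cV[R[i]]_N) :
  D ^t* *m D = 1%:M ->
  (sensing_block D Phi u) ^t* *m sensing_block D Phi v =
  Phi ^t* *m ((diag_mx u^T) ^t* *m diag_mx v^T) *m Phi.
Proof.
move=> DD1; rewrite /sensing_block !trmx_mul !map_mxM !mulmxA.
(* With all products associated to the left, only [D ^t* *m D] has to be regrouped. *)
by rewrite -(mulmxA _ (D ^t*) D) DD1 mulmx1.
Qed.

Theorem proposition2 (R : realType) (N L Q : nat)
  (hN : (0 < N)%N) (hL : (0 < L)%N) (hQ : (0 < Q)%N)
  (g : guard_mode R)
  (D : 'M[R[i]]_N) (hD : D ^t* *m D = 1%:M)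
  (Phi : 'M[R[i]]_(N, Q))
  (xp xu : 'cV[R[i]]_N)
  (horth : forall l m : 'I_L,
     hadamard (conj_mx (shifted_vec g l xp)) (shifted_vec g m xu) = 0) :
  forall l m : 'I_L,
    (sensing_block D Phi (shifted_vec g l xp)) ^t*
      *m sensing_block D Phi (shifted_vec g m xu) = 0.
Proof.
move=> l m.
by rewrite sensing_block_adjM // mul_diag_adj_eq0 // mulmx0 mul0mx.
Qed.
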